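(* Let $X$ and $Y$ be metric $1$-spaces with $X$ object compact as well as forward and backward compact. Then the mapping $1$-space $[X,Y]$, with weights $w(\alpha)=\sup_{x\in ob(X)}w(\alpha_x)$ for natural transformations $\alpha$, is a metric $1$-space.
   Context: $\mathbb{R}_+=[0,\infty)\cup\{\infty\}$. A metric $1$-space is a category $X$ together with a weight $w(\psi)\in\mathbb{R}_+$ for every arrow $\psi$ of $X$ such that $w(id_x)=0$ for every object $x$, and the full triangle inequality $|w(\varphi)-w(\psi)|\le w(\varphi\circ\psi)\le w(\varphi)+w(\psi)$ holds for all composable arrows $\psi:x\to y$, $\varphi:y\to z$. Conventions: $r+\infty=\infty+r=\infty+\infty=\infty$ and $|r-\infty|=|\infty-r|=\infty$ for real $r\ge 0$; if $w(\varphi)=w(\psi)=\infty$ no lower bound on $w(\varphi\circ\psi)$ is imposed. A functor $F:X\to Y$ between metric $1$-spaces is forward continuous at an arrow $\psi:x\to z$ if for every $\epsilon>0$ there is $\delta>0$ such that whenever $\psi=\rho\circ\tau$ with $\tau:x\to y$, $\rho:y\to z$ and $w(\rho)<\delta$, then $w(F(\rho))<\epsilon$. Dually, $F$ is backward continuous at $\psi$ if for every $\epsilon>0$ there is $\delta>0$ such that whenever $\psi=\rho\circ\tau$ with $w(\tau)<\delta$, then $w(F(\tau))<\epsilon$. $F$ is forward (backward) continuous if it is so at every arrow. A forward sequence in $X$ is a family of arrows $\{\psi_n:x\to x_n\}_{n\ge 0}$ with common domain; it converges if there are an object $y$, an index $m$ and arrows $\rho_k:x_k\to y$ ($k\ge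 m$) such that the composites $\rho_k\circ\psi_k$, $k\ge m$, are all equal and $\lim_{k\to\infty}w(\rho_k)=0$. Dually, a backward sequence is a family $\{\psi_n:x_n\to x\}_{n\ge 0}$; it converges if there are $y$, $m$ and $\rho_k:y\to x_k$ ($k\ge m$) such that the composites $\psi_k\circ\rho_k$ are all equal and $\lim_{k\to\infty} w(\rho_k)=0$. $X$ is forward (backward) compact if every forward (backward) sequence has a convergent subsequence. $X$ is object compact if for every sequence $\{x_n\}_{n\ge1}$ of objects there is an object $x_0$ such that for every $\epsilon>0$ and $N\in\mathbb{N}$ there exist $m,n>N$ and arrows $\psi:x_n\to x_0$, $\varphi:x_0\to x_m$ with $w(\psi)<\epsilon$ and $w(\varphi)<\epsilon$. For $X$ object compact and forward and backward compact, the paper asserts that a functor $F:X\to Y$ is forward continuous if and only if it is backward continuous, and then calls such $F$ simply continuous. The mapping $1$-space $[X,Y]$ is the category whose objects are the continuous functors $X\to Y$ and whose arrows are all natural transformations between them, with the usual (vertical) composition $(\beta\circ\alpha)_x=\beta_x\circ\alpha_x$. *)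

(* Defs.v *)
From mathcomp Require Import all_boot all_order all_algebra.
From mathcomp Require Import all_classical all_reals all_analysis.
From mathcomp Require Import lra.
Import Order.TTheory GRing.Theory Num.Theory.
Import numFieldNormedType.Exports.

Set Implicit Arguments.
Unset Strict Implicit.
Unset Printing Implicit Defensive.

Local Open Scope classical_set_scope.
Local Open Scope ring_scope.
Local Open Scope ereal_scope.

Declare Scope metric_1space_scope.
Delimit Scope metric_1space_scope with M1.
Local Open Scope metric_1space_scope.

Reserved Notation "g \oc f" (at level 50, left associativity).

Record category := Category {
  object :> Type;
  arrow : object -> object -> Type;
  id_arrow : forall x, arrow x x;
  compose : forall x y z, arrow y z -> arrow x y -> arrow x z;
  compose1f : forall x y (f : arrow x y), compose (id_arrow y) f = f;
  composef1 : forall x y (f : arrow x y), compose f (id_arrow x) = f;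
  composeA : forall x y z t (h : arrow z t) (g : arrow y z) (f : arrow x y),
    compose h (compose g f) = compose (compose h g) f }.

Notation "g \oc f" := (compose g f) : metric_1space_scope.

Record functor (C D : category) := Functor {
  fobj :> C -> D;
  fmap : forall x y : C, arrow x y -> arrow (fobj x) (fobj y);
  fmap1 : forall x : C, fmap (id_arrow x) = id_arrow (fobj x);
  fmapM : forall (x y z : C) (g : arrow y z) (f : arrow x y),
    fmap (g \oc f) = fmap g \oc fmap f }.

Record nat_trans (C D : category) (F G : functor C D) := NatTrans {
  component :> forall x : C, arrow (F x) (G x);
  naturality : forall (x y : C) (f : arrow x y),
    component y \oc fmap F f = fmap G f \oc component x }.

Lemma nat_transP (C D : category) (F G : functor C D) (a b : nat_trans F G) :
  (forall x, a x = b x) -> a = b.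
Proof.
case: a b => [a na] [b nb] /= ab.
have {}ab : a = b by apply: functional_extensionality_dep.
by case: _ / ab in nb *; rewrite (Prop_irrelevance na nb).
Qed.

Section NatTransOperations.
Variables C D : category.

Lemma nt_id_naturality (F : functor C D) (x y : C) (f : arrow x y) :
  id_arrow (F y) \oc fmap F f = fmap F f \oc id_arrow (F x).
Proof. by rewrite compose1f composef1. Qed.

Definition nt_id (F : functor C D) : nat_trans F F :=
  NatTrans (@nt_id_naturality F).

Lemma nt_comp_naturality (F G H : functor C D) (b : nat_trans G H)
    (a : nat_trans F G) (x y : C) (f : arrow x y) :
  (b y \oc a y) \oc fmap F f = fmap H f \oc (b x \oc a x).
Proof. by rewrite -composeA naturality composeA naturality -composeA. Qed.

Definition nt_comp (F G H : functor C D) (b : nat_trans G H)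
    (a : nat_trans F G) : nat_trans F H :=
  NatTrans (nt_comp_naturality b a).

Lemma nt_comp1f (F G : functor C D) (a : nat_trans F G) :
  nt_comp (nt_id G) a = a.
Proof. by apply: nat_transP => x; apply: compose1f. Qed.

Lemma nt_compf1 (F G : functor C D) (a : nat_trans F G) :
  nt_comp a (nt_id F) = a.
Proof. by apply: nat_transP => x; apply: composef1. Qed.

Lemma nt_compA (F G H K : functor C D) (c : nat_trans H K)
    (b : nat_trans G H) (a : nat_trans F G) :
  nt_comp c (nt_comp b a) = nt_comp (nt_comp c b) a.
Proof. by apply: nat_transP => x; apply: composeA. Qed.

End NatTransOperations.

(* In \bar R, `|+oo - +oo| = +oo; the side condition of the lower bound is
   what leaves the composite of two arrows of infinite weight unconstrained. *)
Record is_metric_1space (R : realType) (C : category)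
    (w : forall x y : C, arrow x y -> \bar R) : Prop := IsMetric1Space {
  weight_ge0 : forall (x y : C) (f : arrow x y), 0 <= w x y f;
  weight_id : forall x : C, w x x (id_arrow x) = 0;
  weight_comp_le : forall (x y z : C) (g : arrow y z) (f : arrow x y),
    w x z (g \oc f) <= w y z g + w x y f;
  weight_comp_ge : forall (x y z : C) (g : arrow y z) (f : arrow x y),
    ~ (w y z g = +oo /\ w x y f = +oo) ->
    `|w y z g - w x y f| <= w x z (g \oc f) }.

Record metric_1space (R : realType) := Metric1Space {
  m1_category :> category;
  weight : forall x y : m1_category, arrow x y -> \bar R;
  weightP : is_metric_1space weight }.

Section Compactness.
Variables (R : realType) (X : metric_1space R).

(* The arrows rho_k, k >= m, are given as a family indexed by k - m. *)
Definition forward_converges (x : X) (xs : nat -> X)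
    (psi : forall n, arrow x (xs n)) : Prop :=
  exists (y : X) (m : nat) (rho : forall k, arrow (xs (m + k)%N) y),
    (forall k l, rho k \oc psi (m + k)%N = rho l \oc psi (m + l)%N) /\
    weight (rho k) @[k --> \oo] --> 0.

Definition backward_converges (x : X) (xs : nat -> X)
    (psi : forall n, arrow (xs n) x) : Prop :=
  exists (y : X) (m : nat) (rho : forall k, arrow y (xs (m + k)%N)),
    (forall k l, psi (m + k)%N \oc rho k = psi (m + l)%N \oc rho l) /\
    weight (rho k) @[k --> \oo] --> 0.

Definition forward_compact : Prop :=
  forall (x : X) (xs : nat -> X) (psi : forall n, arrow x (xs n)),
    exists2 s : nat -> nat, {homo s : m n / (m < n)%N} &
      forward_converges (fun n => psi (s n)).

Definition backward_compact : Prop :=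
  forall (x : X) (xs : nat -> X) (psi : forall n, arrow (xs n) x),
    exists2 s : nat -> nat, {homo s : m n / (m < n)%N} &
      backward_converges (fun n => psi (s n)).

Definition object_compact : Prop :=
  forall xs : nat -> X, exists x0 : X, forall (e : R) (N : nat), (0 < e)%R ->
    exists (m n : nat) (psi : arrow (xs n) x0) (phi : arrow x0 (xs m)),
      [/\ (N < m)%N, (N < n)%N, weight psi < e%:E & weight phi < e%:E].

End Compactness.

Section Continuity.
Variables (R : realType) (X Y : metric_1space R) (F : functor X Y).

Definition forward_continuous_at (x z : X) (psi : arrow x z) : Prop :=
  forall e : R, (0 < e)%R -> exists2 d : R, (0 < d)%R &
    forall (y : X) (tau : arrow x y) (rho : arrow y z), psi = rho \oc tau ->
      weight rho < d%:E -> weight (fmap F rho) < e%:E.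

Definition backward_continuous_at (x z : X) (psi : arrow x z) : Prop :=
  forall e : R, (0 < e)%R -> exists2 d : R, (0 < d)%R &
    forall (y : X) (tau : arrow x y) (rho : arrow y z), psi = rho \oc tau ->
      weight tau < d%:E -> weight (fmap F tau) < e%:E.

Definition forward_continuous : Prop :=
  forall (x z : X) (psi : arrow x z), forward_continuous_at psi.

Definition backward_continuous : Prop :=
  forall (x z : X) (psi : arrow x z), backward_continuous_at psi.

(* Over a forward and backward compact X the two conditions are equivalent, see
   forward_backward_continuous below. *)
Definition continuous_functor : Prop :=
  forward_continuous /\ backward_continuous.

End Continuity.

Lemma weight_le_comp (R : realType) (X : metric_1space R) (x y z : X)
    (g : arrow y z) (f : arrow x y) :
  weight f <= weight g + weight (g \oc f) /\
  weight g <= weight f + weight (g \oc f).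
Proof.
have := @weight_comp_ge _ _ _ (weightP X) x y z g f.
have := @weight_ge0 _ _ _ (weightP X) _ _ g.
have := @weight_ge0 _ _ _ (weightP X) _ _ f.
have := @weight_ge0 _ _ _ (weightP X) _ _ (g \oc f).
case: (weight (g \oc f)) => [c||] //; case: (weight g) => [a||] //;
  case: (weight f) => [b||] // _ _ _ H; rewrite ?leey //;
  try by have /= := H _; rewrite leye_eq => E; suff: false by []; apply: E; case.
have /ler_normlP[] : (`|a - b| <= c)%R by rewrite -lee_fin; apply: H; case.
rewrite -!EFinD !lee_fin => ? ?.
by split; lra.
Qed.

Lemma small_sum (R : realType) (a b : \bar R) (d : R) :
  a < (d / 2)%:E -> b < (d / 2)%:E -> a + b < d%:E.
Proof. by move=> ad bd; rewrite [d in ltRHS]splitr EFinD lteD. Qed.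

Lemma homo_ltn_ge (s : nat -> nat) : {homo s : m n / (m < n)%N} ->
  forall n, (n <= s n)%N.
Proof. by move=> hs; elim=> // n IHn; apply: leq_ltn_trans IHn (hs _ _ _). Qed.

Lemma near_small (R : realType) (a b : nat -> \bar R) (s : nat -> nat)
    (m : nat) (d : R) : (0 < d)%R ->
  (forall n, b n < (n.+1%:R^-1)%:E) -> {homo s : m n / (m < n)%N} ->
  a k @[k --> \oo] --> 0 ->
  exists k, a k < d%:E /\ b (s (m + k)%N) < d%:E.
Proof.
move=> d0 bs hs a0.
have A : \forall k \near \oo, a k < d%:E.
  by apply: (a0 [set u | u < d%:E]); apply: open_ereal_lt'; rewrite lte_fin.
have [k [ak nk]] : exists k : nat, a k < d%:E /\ (k.+1%:R^-1 < d)%R.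
  apply: (@filter_ex _ \oo); near=> k; split; near: k => //.
  exact: near_infty_natSinv_lt (PosNum d0).
exists k; split => //; apply: (lt_trans (bs _)); rewrite lte_fin.
apply: le_lt_trans nk; rewrite lef_pV2 ?posrE// ler_nat ltnS.
by apply: leq_trans (homo_ltn_ge hs _); rewrite leq_addl.
Unshelve. all: by end_near. Qed.

Section ContinuityEquivalence.
Variables (R : realType) (X Y : metric_1space R) (F : functor X Y).

Lemma forward_continuousW :
  forward_compact X -> forward_continuous F -> backward_continuous F.
Proof.
move=> cX cF x z psi e e0; apply: contrapT => nd.
have step n : exists p : {y : X & (arrow x y * arrow y z)%type},
    weight (projT2 p).1 < (n.+1%:R^-1)%:E /\
    e%:E <= weight (fmap F (projT2 p).1).
  apply: contrapT => np; apply: nd; exists n.+1%:R^-1%R; first by rewrite invr_gt0.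
  move=> y tau rho _ wt; rewrite ltNge; apply/negP => et.
  by apply: np; exists (existT _ y (tau, rho)).
have [p pP] := choice step.
have [s hs [y [m [rho [rhoE rho0]]]]] := cX x _ (fun n => (projT2 (p n)).1).
pose chi := rho 0%N \oc (projT2 (p (s (m + 0)%N))).1.
have small d : (0 < d)%R -> exists k, weight (rho k) < d%:E /\
    weight (projT2 (p (s (m + k)%N))).1 < d%:E.
  by move=> d0; apply: near_small d0 (fun n => (pP n).1) hs rho0.
have e20 : (0 < e / 2)%R by rewrite divr_gt0.
have [d d0 dP] := cF _ _ chi _ e20.
have chi_d : weight chi < d%:E.
  have [k [k1 k2]] := small _ (divr_gt0 d0 (ltr0Sn R 1)).
  rewrite /chi (rhoE 0%N k).
  exact: le_lt_trans (weight_comp_le (weightP X) _ _) (small_sum k1 k2).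
have Fchi := dP _ (id_arrow x) chi (esym (composef1 _)) chi_d.
have [k [k1 _]] := small _ d0.
have Frho := dP _ _ _ (rhoE 0%N k) k1.
have := (weight_le_comp (fmap F (rho k))
  (fmap F (projT2 (p (s (m + k)%N))).1)).1.
rewrite -fmapM -(rhoE 0%N k) => le1.
have := le_lt_trans (le_trans (pP _).2 le1) (small_sum Frho Fchi).
by rewrite ltxx.
Qed.

Lemma backward_continuousW :
  backward_compact X -> backward_continuous F -> forward_continuous F.
Proof.
move=> cX cF x z psi e e0; apply: contrapT => nd.
have step n : exists p : {y : X & (arrow x y * arrow y z)%type},
    weight (projT2 p).2 < (n.+1%:R^-1)%:E /\
    e%:E <= weight (fmap F (projT2 p).2).
  apply: contrapT => np; apply: nd; exists n.+1%:R^-1%R; first by rewrite invr_gt0.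
  move=> y tau rho _ wt; rewrite ltNge; apply/negP => et.
  by apply: np; exists (existT _ y (tau, rho)).
have [p pP] := choice step.
have [s hs [y [m [rho [rhoE rho0]]]]] := cX z _ (fun n => (projT2 (p n)).2).
pose chi := (projT2 (p (s (m + 0)%N))).2 \oc rho 0%N.
have small d : (0 < d)%R -> exists k, weight (rho k) < d%:E /\
    weight (projT2 (p (s (m + k)%N))).2 < d%:E.
  by move=> d0; apply: near_small d0 (fun n => (pP n).1) hs rho0.
have e20 : (0 < e / 2)%R by rewrite divr_gt0.
have [d d0 dP] := cF _ _ chi _ e20.
have chi_d : weight chi < d%:E.
  have [k [k1 k2]] := small _ (divr_gt0 d0 (ltr0Sn R 1)).
  rewrite /chi (rhoE 0%N k).
  exact: le_lt_trans (weight_comp_le (weightP X) _ _) (small_sum k2 k1).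
have Fchi := dP _ chi (id_arrow z) (esym (compose1f _)) chi_d.
have [k [k1 _]] := small _ d0.
have Frho := dP _ _ _ (rhoE 0%N k) k1.
have := (weight_le_comp (fmap F (projT2 (p (s (m + k)%N))).2)
  (fmap F (rho k))).2.
rewrite -fmapM -(rhoE 0%N k) => le1.
have := le_lt_trans (le_trans (pP _).2 le1) (small_sum Frho Fchi).
by rewrite ltxx.
Qed.

Lemma forward_backward_continuous :
  forward_compact X -> backward_compact X ->
  forward_continuous F <-> backward_continuous F.
Proof.
by move=> fX bX; split; [apply: forward_continuousW|apply: backward_continuousW].
Qed.

End ContinuityEquivalence.

Section MappingSpace.
Variables (R : realType) (X Y : metric_1space R).

Record cfunctor := CFunctor {
  cfunctor_functor :> functor X Y;
  cfunctorP : continuous_functor cfunctor_functor }.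

Definition mapping_category : category :=
  @Category cfunctor (fun F G => nat_trans F G) (fun F => nt_id F)
    (fun F G H => @nt_comp X Y F G H) (fun F G => @nt_comp1f X Y F G)
    (fun F G => @nt_compf1 X Y F G) (fun F G H K => @nt_compA X Y F G H K).

(* The supremum is the one of [0, +oo]: adjoining 0 only matters when X has no
   object, since ereal_sup set0 = -oo. *)
Definition mapping_weight (F G : mapping_category) (a : arrow F G) : \bar R :=
  ereal_sup (0 |` [set weight (component a x) | x in [set: X]]).

End MappingSpace.

(* Main.v *)
(* The two lower bounds contained in the full triangle inequality can be written
   without subtraction, as w(f) <= w(g) + w(g f) and w(g) <= w(f) + w(g f); in
   this form they hold even when both weights are infinite, so they pass to
   suprema componentwise, just like w(g f) <= w(g) + w(f). *)
Require Import Defs.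
From mathcomp Require Import all_boot all_order all_algebra.
From mathcomp Require Import all_classical all_reals all_analysis.
From mathcomp Require Import lra.
Import Order.TTheory GRing.Theory Num.Theory.

Set Implicit Arguments.
Unset Strict Implicit.
Unset Printing Implicit Defensive.

Local Open Scope classical_set_scope.
Local Open Scope ereal_scope.
Local Open Scope metric_1space_scope.

(** If exactly one of [a], [b] is [+oo], the bound on it forces [c = +oo]. Both infinite must be
    excluded, since then the left side is [+oo] whatever [c] is. *)
Lemma lee_abs_sub (R : realType) (a b c : \bar R) :
  0 <= a -> 0 <= b -> ~ (a = +oo /\ b = +oo) ->
  b <= a + c -> a <= b + c -> `|a - b| <= c.
Proof.
case: a b c => [a||] [b||] [c||] //= _ _ nab; rewrite ?leey //.
  rewrite -!EFinD !lee_fin => ba ab.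
  by apply/ler_normlP; split; lra.
by case: nab.
Qed.

Section MappingWeight.
Variables (R : realType) (X Y : metric_1space R).
Implicit Types F G H : mapping_category X Y.

Lemma mapping_weight_ge0 F G (a : arrow F G) : 0 <= mapping_weight a.
Proof. by apply: ereal_sup_ubound; left. Qed.

Lemma weight_component_le F G (a : arrow F G) (x : X) :
  weight (component a x) <= mapping_weight a.
Proof. by apply: ereal_sup_ubound; right; exists x. Qed.

(** [0 <= c] accounts for the 0 adjoined to the supremum. *)
Lemma mapping_weight_le F G (a : arrow F G) (c : \bar R) : 0 <= c ->
  (forall x, weight (component a x) <= c) -> mapping_weight a <= c.
Proof. by move=> c0 ac; apply: ge_ereal_sup => _ [->|[x _ <-]]. Qed.

End MappingWeight.

Theorem theorem7p12 (R : realType) (X Y : metric_1space R)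
    (obj_cpt : object_compact X) (fwd_cpt : forward_compact X)
    (bwd_cpt : backward_compact X) :
  is_metric_1space (@mapping_weight R X Y).
Proof.
split=> [F G a|F|F G H b a|F G H b a ab].
- exact: mapping_weight_ge0.
- apply/le_anti/andP; split; last exact: mapping_weight_ge0.
  by apply: mapping_weight_le => // x; rewrite (weight_id (weightP Y)).
- apply: mapping_weight_le => [|x]; first by rewrite adde_ge0 ?mapping_weight_ge0.
  apply: le_trans (weight_comp_le (weightP Y) _ _) _.
  by apply: leeD; apply: weight_component_le.
(* [ab] serves only to return from the two subtraction-free bounds to the absolute value. *)
- apply: lee_abs_sub => //; try exact: mapping_weight_ge0.
  + apply: mapping_weight_le => [|x].
      by rewrite adde_ge0 ?mapping_weight_ge0.
    apply: le_trans (weight_le_comp (component b x) (component a x)).1 _.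
    (* By definition, [component b x \oc component a x] is the component of [b \oc a] at [x]. *)
    by apply: leeD; [|apply: (weight_component_le (b \oc a))];
      apply: weight_component_le.
  + apply: mapping_weight_le => [|x].
      by rewrite adde_ge0 ?mapping_weight_ge0.
    apply: le_trans (weight_le_comp (component b x) (component a x)).2 _.
    by apply: leeD; [|apply: (weight_component_le (b \oc a))];
      apply: weight_component_le.
Qed.
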